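(* Let $H=\mathbb{C}[\mathcal{A}_4]$ with the differential calculus defined by the conjugacy class $\mathcal{C}=\{t,x,y,z\}$, let $\mu\neq-\frac14$, and consider the invariant metric $\eta^{a,b}=\delta_{a,b}+\mu$, the Levi-Civita connection $A_a=e_a-\frac14\theta$, and the gamma-matrices $\gamma_a$ associated to $\eta$ and the 3-dimensional representation $\rho_W$ (all as specified in the context). The Dirac operator on $\mathcal{A}_4$ is given by $$D\!\!\!\!/=\sum_{a\in\mathcal{C}}\partial^a\gamma_a-4 .$$ For $\mu=0$ it is explicitly $$D\!\!\!\!/=\begin{pmatrix}-R_t-R_x-R_y-R_z&0&R_t-R_x-R_y+R_z\\ R_t-R_x+R_y-R_z&-R_t-R_x-R_y-R_z&0\\ 0&R_t+R_x-R_y-R_z&-R_t-R_x-R_y-R_z\end{pmatrix}.$$ This operator (for $\mu=0$), acting on the 36-dimensional space of spinor fields, has 18 zero modes, 3 modes with each of the eigenvalues $4$ and $-4$, 3 modes with each of the eigenvalues $4q$ and $-4q$, and 3 modes with each of the eigenvalues $4\bar q$ and $-4\bar q$, where $q=e^{2\pi\imath/3}$ (the numbers of modes being the dimensions of the corresponding eigenspaces).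
   Context: $\mathcal{A}_4$ is the alternating group of order 12 with identity $e$, products of permutations composed right to left. Put $t=(123)$, $u=(14)(23)$, $v=(12)(34)$, $w=(13)(24)$, $x=ut=(134)$, $y=vt=(243)$, $z=wt=(142)$, $\mathcal{C}=\{t,x,y,z\}$. $H=\mathbb{C}[\mathcal{A}_4]$ is the algebra of complex functions; $(R_af)(g)=f(ga)$, $\partial^a=R_a-\mathrm{id}$. $\Omega^1(H)$ is the free left $H$-module with basis the Maurer-Cartan 1-forms $\{e_a\}_{a\in\mathcal{C}}$, and $\theta=\sum_{a\in\mathcal{C}}e_a$. The component functions $A_a^b$ of the connection are defined by $A_a=\sum_bA_a^be_b$. The spinor representation $\rho_W$ of $\mathcal{A}_4$ on $W=\mathbb{C}^3$ is (extended linearly to the group algebra) $$\rho_W(t)=\begin{pmatrix}0&0&1\\1&0&0\\0&1&0\end{pmatrix},\quad \rho_W(u)=\mathrm{diag}(-1,-1,1),\quad \rho_W(v)=\mathrm{diag}(-1,1,-1),\quad \rho_W(w)=\mathrm{diag}(1,-1,-1).$$ The gamma-matrices are $\gamma_a=\sum_{b\in\mathcal{C}}\eta^{-1}_{ab}\,\rho_W(b-e)$, where $\eta^{-1}$ is the inverse of the matrix $(\eta^{a,b})$. A spinor field is a $W$-valued function on $\mathcal{A}_4$ (a column of 3 functions, on which matrices of operators act in the usual way). The Dirac operator on spinor fields is $$D\!\!\!\!/=\sum_a\partial^a\gamma_a-\sum_{a,b}A_a^b\gamma_b\tau_W^a,\qquad\tau_W^a=\rho_W(a^{-1}-e),$$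 where $\partial^a$ acts on the function components and the matrices act on $W$. *)

(* Defs.v *)
From HB Require Import structures.
From mathcomp Require Import all_boot all_order all_algebra all_fingroup all_solvable.
From mathcomp Require Import reals sequences exp trigo complex.

Set Implicit Arguments.
Unset Strict Implicit.
Unset Printing Implicit Defensive.
Import Order.TTheory GRing.Theory Num.Theory.
Local Open Scope ring_scope.

Definition A4 : finGroupType := [subg 'Alt_('I_4)].

(* Product of permutations composed right to left: the MathComp product
   [s * t] of permutations applies s first. *)
Definition comp4 (g h : A4) : A4 := (h * g)%g.

(* The points 1, 2, 3, 4 permuted by A4, as elements of 'I_4. *)
Definition pt (k : nat) : 'I_4 := inord k.-1.

(* [subg _ p] is p itself, seen in A4, because p is even. *)
Definition t4 : A4 :=
  subg 'Alt_('I_4) (tperm (pt 1) (pt 2) * tperm (pt 1) (pt 3))%g.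
Definition u4 : A4 :=
  subg 'Alt_('I_4) (tperm (pt 1) (pt 4) * tperm (pt 2) (pt 3))%g.
Definition v4 : A4 :=
  subg 'Alt_('I_4) (tperm (pt 1) (pt 2) * tperm (pt 3) (pt 4))%g.
Definition w4 : A4 :=
  subg 'Alt_('I_4) (tperm (pt 1) (pt 3) * tperm (pt 2) (pt 4))%g.
Definition x4 : A4 := comp4 u4 t4.
Definition y4 : A4 := comp4 v4 t4.
Definition z4 : A4 := comp4 w4 t4.

(* The conjugacy class C = {t, x, y, z}; the indices a, b in C are represented
   by their positions in this tuple. *)
Definition class4 : 4.-tuple A4 := [tuple t4; x4; y4; z4].
Definition cl (a : 'I_4) : A4 := tnth class4 a.

Definition klein4 : 4.-tuple A4 := [tuple 1%g; u4; v4; w4].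

Definition mx3 (V : nmodType) (rows : seq (seq V)) : 'M[V]_3 :=
  \matrix_(i, j) (nth [::] rows i)`_j.

Definition rho_t (K : numFieldType) : 'M[K]_3 :=
  mx3 [:: [:: 0; 0; 1]; [:: 1; 0; 0]; [:: 0; 1; 0]].
Definition rho_u (K : numFieldType) : 'M[K]_3 :=
  mx3 [:: [:: -1; 0; 0]; [:: 0; -1; 0]; [:: 0; 0; 1]].
Definition rho_v (K : numFieldType) : 'M[K]_3 :=
  mx3 [:: [:: -1; 0; 0]; [:: 0; 1; 0]; [:: 0; 0; -1]].
Definition rho_w (K : numFieldType) : 'M[K]_3 :=
  mx3 [:: [:: 1; 0; 0]; [:: 0; -1; 0]; [:: 0; 0; -1]].

Definition rho_klein (K : numFieldType) : 4.-tuple 'M[K]_3 :=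
  [tuple 1%:M; rho_u K; rho_v K; rho_w K].

(* Every g in A4 is n t^k for a unique n in {e, u, v, w} and a unique k < 3;
   the value at g is then forced to be rho(n) rho(t)^k. *)
Definition rhoW (K : numFieldType) (g : A4) : 'M[K]_3 :=
  if [pick p : 'I_4 * 'I_3 | g == comp4 (tnth klein4 p.1) (t4 ^+ p.2)%g]
  is Some p then tnth (rho_klein K) p.1 *m rho_t K ^+ p.2 else 0.

Lemma A4valE (p : {perm 'I_4}) : ~~ odd_perm p -> sgval (subg 'Alt_('I_4) p) = p.
Proof. by move=> ep; apply: subgK; rewrite Alt_even. Qed.

Lemma A4ext (g h : A4) : (forall k, (sgval g) k = (sgval h) k) -> g = h.
Proof. by move=> e; apply: val_inj; apply/permP. Qed.

Lemma comp4E (g h : A4) k : sgval (comp4 g h) k = sgval g (sgval h k).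
Proof. by rewrite /comp4 /= permM. Qed.

Lemma ptE (k : nat) : (0 < k < 5)%N -> nat_of_ord (pt k) = k.-1.
Proof. by case: k => // k; rewrite ltnS => hk; rewrite /pt inordK. Qed.

Lemma pt_eq (k l : nat) : (0 < k < 5)%N -> (0 < l < 5)%N ->
  (pt k == pt l) = (k == l).
Proof.
by move=> hk hl; rewrite -val_eqE /= !ptE //; case: k hk => //; case: l hl.
Qed.

Lemma ptP (k : 'I_4) : [\/ k = pt 1, k = pt 2, k = pt 3 | k = pt 4].
Proof.
by case: k => [[|[|[|[|]]]] lt_k] //;
  [constructor 1|constructor 2|constructor 3|constructor 4];
  apply: val_inj; rewrite /= ptE.
Qed.

Lemma t4E : [/\ sgval t4 (pt 1) = pt 2, sgval t4 (pt 2) = pt 3,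
  sgval t4 (pt 3) = pt 1 & sgval t4 (pt 4) = pt 4].
Proof.
by rewrite A4valE ?odd_permM ?odd_tperm ?pt_eq // !permM !permE /= !pt_eq //=
  !permE /= !pt_eq.
Qed.

Lemma u4E : [/\ sgval u4 (pt 1) = pt 4, sgval u4 (pt 2) = pt 3,
  sgval u4 (pt 3) = pt 2 & sgval u4 (pt 4) = pt 1].
Proof.
by rewrite A4valE ?odd_permM ?odd_tperm ?pt_eq // !permM !permE /= !pt_eq //=
  !permE /= !pt_eq.
Qed.

Lemma v4E : [/\ sgval v4 (pt 1) = pt 2, sgval v4 (pt 2) = pt 1,
  sgval v4 (pt 3) = pt 4 & sgval v4 (pt 4) = pt 3].
Proof.
by rewrite A4valE ?odd_permM ?odd_tperm ?pt_eq // !permM !permE /= !pt_eq //=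
  !permE /= !pt_eq.
Qed.

Lemma w4E : [/\ sgval w4 (pt 1) = pt 3, sgval w4 (pt 2) = pt 4,
  sgval w4 (pt 3) = pt 1 & sgval w4 (pt 4) = pt 2].
Proof.
by rewrite A4valE ?odd_permM ?odd_tperm ?pt_eq // !permM !permE /= !pt_eq //=
  !permE /= !pt_eq.
Qed.

Definition elt4 (p : 'I_4 * 'I_3) : A4 := comp4 (tnth klein4 p.1) (t4 ^+ p.2)%g.

Lemma elt4E (p : 'I_4 * 'I_3) k :
  sgval (elt4 p) k = sgval (tnth klein4 p.1) (iter p.2 (sgval t4) k).
Proof.
rewrite /elt4 comp4E; congr (_ _); elim: (nat_of_ord p.2) => [|m IH].
  by rewrite expg0 perm1.
by rewrite expgSr [sgval _]/= permM iterS -IH.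
Qed.

Lemma elt4_inj : injective elt4.
Proof.
have [t1 t2 t3 t4'] := t4E; have [u1 u2 u3 u4'] := u4E.
have [v1 v2 v3 v4'] := v4E; have [w1 w2 w3 w4'] := w4E.
move=> [n k] [n' k'] e.
have e4 : sgval (elt4 (n, k)) (pt 4) = sgval (elt4 (n', k')) (pt 4) by rewrite e.
have e1 : sgval (elt4 (n, k)) (pt 1) = sgval (elt4 (n', k')) (pt 1) by rewrite e.
have it4 m : iter m (sgval t4) (pt 4) = pt 4.
  by elim: m => //= m ->.
move: e4; rewrite !elt4E /= !it4 => e4.
have en : n = n'.
  move: n n' {e e1} e4 => [[|[|[|[|]]]] hn] // [[|[|[|[|]]]] hn'] //;
  rewrite !(tnth_nth 1%g) /= ?perm1 ?u4' ?v4' ?w4' => /eqP; rewrite ?pt_eq //= => _;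
  exact: val_inj.
move: e1; rewrite -en !elt4E /= => /perm_inj e1.
congr pair; move: k k' {e} e1 => [[|[|[|]]] hk] // [[|[|[|]]] hk'] //=;
rewrite ?t1 ?t2 => /eqP; rewrite ?pt_eq //= => _; exact: val_inj.
Qed.

Lemma card_A4 : #|A4| = 12%N.
Proof.
have := @card_Alt 'I_4; rewrite card_ord => /(_ isT).
by rewrite card_sub => /eqP; rewrite -[4`!]/(2 * 12)%N eqn_pmul2l // => /eqP.
Qed.

Lemma elt4_surj g : exists p, g = elt4 p.
Proof.
have /(inj_card_onto elt4_inj) : (#|A4| <= #|{: 'I_4 * 'I_3}|)%N.
  by rewrite card_A4 card_prod !card_ord.
by move=> /(_ g) /codomP.
Qed.


(* rhoW permutes the four vertices of a tetrahedron in K^3 as A4 permutes the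
   points; this determines rhoW and makes it multiplicative. *)
Definition vert (K : numFieldType) (i : 'I_4) : 'cV[K]_3 :=
  \col_j (nth [::] [:: [:: -1; -1; 1]; [:: 1; -1; -1]; [:: -1; 1; -1];
                       [:: 1; 1; 1]] i)`_j.

Lemma vert_ext (K : numFieldType) (A B : 'M[K]_3) :
  (forall i, A *m vert K i = B *m vert K i) -> A = B.
Proof.
have delta_vert (j : 'I_3) : exists i : 'I_4,
    2 *: delta_mx j 0 = vert K (pt 4) + vert K i.
  case: j => [[|[|[|]]] hj] //; [exists (pt 2)|exists (pt 3)|exists (pt 1)];
  apply/colP => -[[|[|[|]]] hl] //; rewrite !mxE !ptE //= -?val_eqE /=;
  rewrite ?mulr1 ?mulr0 ?subrr //.
move=> AB; have n2 : (2 : K) != 0 by rewrite pnatr_eq0.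
apply/matrixP=> i j; have [l hl] := delta_vert j.
have /(congr1 (fun M : 'cV_3 => M i 0)) :
    A *m (2 *: delta_mx j 0) = B *m (2 *: delta_mx j 0) :> 'cV_3.
  by rewrite hl !mulmxDr !AB.
by rewrite -!scalemxAr -!colE !mxE => /(mulfI n2).
Qed.

Lemma rho_t_vert (K : numFieldType) i :
  rho_t K *m vert K i = vert K (sgval t4 i).
Proof.
have [t1 t2 t3 t4'] := t4E.
case: (ptP i) => ->; rewrite ?t1 ?t2 ?t3 ?t4'; apply/colP => -[[|[|[|]]] hl] //;
rewrite !mxE !big_ord_recl big_ord0 !mxE !ptE //=;
by rewrite ?mul0r ?mul1r ?addr0 ?add0r.
Qed.

Lemma rho_klein_vert (K : numFieldType) n i :
  tnth (rho_klein K) n *m vert K i = vert K (sgval (tnth klein4 n) i).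
Proof.
have [u1 u2 u3 u4'] := u4E.
have [v1 v2 v3 v4'] := v4E; have [w1 w2 w3 w4'] := w4E.
case: n => -[|[|[|[|]]]] hn //; rewrite (tnth_nth 0) (tnth_nth 1%g) /=.
- by rewrite mul1mx perm1.
all: case: (ptP i) => ->; rewrite ?(u1, u2, u3, u4', v1, v2, v3, v4', w1, w2, w3, w4');
  apply/colP => -[[|[|[|]]] hl] //;
  rewrite !mxE !big_ord_recl big_ord0 !mxE !ptE //=;
  by rewrite ?mul0r ?mul1r ?mulN1r ?opprK ?addr0 ?add0r.
Qed.

Lemma rhoW_vert (K : numFieldType) g i :
  rhoW K g *m vert K i = vert K (sgval g i).
Proof.
rewrite /rhoW; case: pickP => [[n k] /= /eqP eg | no]; last first.
  by have [p eg] := elt4_surj g; have := no p; rewrite eg eqxx.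
have -> : g = elt4 (n, k) by [].
rewrite elt4E -mulmxA /= -rho_klein_vert; congr (_ *m _).
elim: (nat_of_ord k) => [|m IH]; first by rewrite expr0 mul1mx.
by rewrite exprS -mulmxE -mulmxA IH rho_t_vert.
Qed.

Lemma rhoW1 (K : numFieldType) : rhoW K 1%g = 1%:M.
Proof. by apply: vert_ext => i; rewrite rhoW_vert mul1mx perm1. Qed.

Lemma rhoWM (K : numFieldType) g h : rhoW K (comp4 g h) = rhoW K g *m rhoW K h.
Proof. by apply: vert_ext => i; rewrite -mulmxA !rhoW_vert comp4E. Qed.

Lemma rhoW_t (K : numFieldType) : rhoW K t4 = rho_t K.
Proof. by apply: vert_ext => i; rewrite rhoW_vert rho_t_vert. Qed.

Lemma rhoW_klein (K : numFieldType) n :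
  rhoW K (tnth klein4 n) = tnth (rho_klein K) n.
Proof. by apply: vert_ext => i; rewrite rhoW_vert rho_klein_vert. Qed.

Lemma rhoW_u (K : numFieldType) : rhoW K u4 = rho_u K.
Proof. exact: (rhoW_klein K 1). Qed.

Lemma rhoW_v (K : numFieldType) : rhoW K v4 = rho_v K.
Proof. exact: (rhoW_klein K (Ordinal (isT : 2 < 4)%N)). Qed.

Lemma rhoW_w (K : numFieldType) : rhoW K w4 = rho_w K.
Proof. exact: (rhoW_klein K (Ordinal (isT : 3 < 4)%N)). Qed.

Lemma conj_t4 : [/\ t4 ^ u4 = y4, t4 ^ v4 = z4 & t4 ^ w4 = x4]%g.
Proof.
have [t1 t2 t3 t4'] := t4E; have [u1 u2 u3 u4'] := u4E.
have [v1 v2 v3 v4'] := v4E; have [w1 w2 w3 w4'] := w4E.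
have tJ g h : (t4 * g)%g = (g * h)%g -> (t4 ^ g)%g = h.
  by rewrite /conjg => ->; rewrite mulKg.
split; apply: tJ; apply: A4ext => k; rewrite /x4 /y4 /z4 /comp4 /= !permM;
by case: (ptP k) => ->;
   rewrite !(t1, t2, t3, t4', u1, u2, u3, u4', v1, v2, v3, v4', w1, w2, w3, w4').
Qed.

Lemma class4E : [set g in class4] = (t4 ^: [set: A4])%g.
Proof.
have [tu tv tw] := conj_t4.
apply/setP => g; rewrite !inE; apply/idP/imsetP.
  case/or4P => /eqP ->; [exists 1%g|exists w4|exists u4|exists v4];
  by rewrite ?inE ?conjg1.
move=> [h _ ->{g}]; have [[n k] ->] := elt4_surj h.
rewrite /elt4 /comp4 conjgM /=.
have -> : (t4 ^ (t4 ^+ k) = t4)%g by apply/conjg_fixP/commgP/commuteX.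
case: n => -[|[|[|[|]]]] hn //; rewrite (tnth_nth 1%g) /=;
by rewrite ?conjg1 ?tu ?tv ?tw eqxx ?orbT.
Qed.

Lemma class4_uniq : uniq class4.
Proof.
have ne (n n' : 'I_4) : n != n' ->
    comp4 (tnth klein4 n) t4 != comp4 (tnth klein4 n') t4.
  apply: contraNneq => /mulgI e.
  have := @elt4_inj (n, 0) (n', 0); rewrite /elt4 /= e => /(_ erefl) [->] //.
pose o1 : 'I_4 := Ordinal (isT : 1 < 4)%N.
pose o2 : 'I_4 := Ordinal (isT : 2 < 4)%N.
pose o3 : 'I_4 := Ordinal (isT : 3 < 4)%N.
have e0 : comp4 (tnth klein4 0) t4 = t4 by rewrite /comp4 mulg1.
have := ne 0 o1 isT; have := ne 0 o2 isT; have := ne 0 o3 isT.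
have := ne o1 o2 isT; have := ne o1 o3 isT; have := ne o2 o3 isT.
rewrite !e0 /= !inE !negb_or /x4 /y4 /z4.
by move=> -> -> -> -> -> ->.
Qed.

(* K^o rather than K, so that function spaces are vector spaces over K. *)
Definition funA4 (K : numFieldType) := {ffun A4 -> K^o}.

Definition Rop (K : numFieldType) (a : A4) : 'End(funA4 K) :=
  linfun (fun f : funA4 K => [ffun g => f (comp4 g a)] : funA4 K).

Definition dop (K : numFieldType) (a : A4) : 'End(funA4 K) := Rop K a - \1%VF.

Definition mulop (K : numFieldType) (h : funA4 K) : 'End(funA4 K) :=
  linfun (fun f : funA4 K => h * f).

Lemma RopE (K : numFieldType) a (f : funA4 K) g : Rop K a f g = f (comp4 g a).
Proof.
pose F (f : funA4 K) : funA4 K := [ffun g => f (comp4 g a)].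
have linF : linear F by move=> c f1 f2; apply/ffunP => k; rewrite !ffunE.
pose Fl := GRing.isLinear.Build _ _ _ _ _ linF.
pose FL : {linear funA4 K -> funA4 K} := HB.pack F Fl.
by rewrite (lfunE FL) /= ffunE.
Qed.

Lemma mulopE (K : numFieldType) (h f : funA4 K) : mulop h f = h * f.
Proof.
have linF : linear (fun f : funA4 K => h * f).
  move=> c f1 f2; apply/ffunP => k; rewrite !ffunE /= mulrDr.
  by congr (_ + _); rewrite /GRing.scale /= mulrCA.
pose Fl := GRing.isLinear.Build _ _ _ _ _ linF.
pose FL : {linear funA4 K -> funA4 K} := HB.pack (fun f : funA4 K => h * f) Fl.
exact: (lfunE FL).
Qed.

(* The 1-forms: the free left module over the function algebra with basis the
   Maurer-Cartan forms e_a; the a-th coordinate of a 1-form is its component. *)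
Definition Omega1 (K : numFieldType) := 'rV[funA4 K]_4.

Definition mc (K : numFieldType) (a : 'I_4) : Omega1 K := delta_mx 0 a.

Definition theta (K : numFieldType) : Omega1 K := \sum_a mc K a.

Definition cstf (K : numFieldType) (c : K) : funA4 K := [ffun => c].

Definition LCconn (K : numFieldType) (a : 'I_4) : Omega1 K :=
  mc K a - cstf (4^-1) *: theta K.

Definition metric (K : numFieldType) (mu : K) : 'M[K]_4 :=
  \matrix_(a, b) ((a == b)%:R + mu).

Definition gam (K : numFieldType) (mu : K) (a : 'I_4) : 'M[K]_3 :=
  \sum_b invmx (metric mu) a b *: (rhoW K (cl b) - rhoW K 1%g).

Definition tau (K : numFieldType) (a : 'I_4) : 'M[K]_3 :=
  rhoW K (cl a)^-1%g - rhoW K 1%g.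

Definition spinor (K : numFieldType) := {ffun 'I_3 -> funA4 K}.

Definition spinop (K : numFieldType) (M : 'M['End(funA4 K)]_3) :
    'End(spinor K) :=
  linfun (fun psi : spinor K => [ffun i => \sum_j M i j (psi j)] : spinor K).

Lemma spinopE (K : numFieldType) (M : 'M['End(funA4 K)]_3) psi i :
  spinop M psi i = \sum_j M i j (psi j).
Proof.
pose F (psi : spinor K) : spinor K := [ffun i => \sum_j M i j (psi j)].
have linF : linear F.
  move=> c p q; apply/ffunP => k; rewrite !ffunE scaler_sumr -big_split /=.
  by apply: eq_bigr => j _; rewrite !ffunE linearP.
pose Fl := GRing.isLinear.Build _ _ _ _ _ linF.
pose FL : {linear spinor K -> spinor K} := HB.pack F Fl.
by rewrite (lfunE FL) /= ffunE.
Qed.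

(* The operator T acting on the components combined with the matrix M acting
   on W. *)
Definition tens (K : numFieldType) (T : 'End(funA4 K)) (M : 'M[K]_3) :
    'M['End(funA4 K)]_3 := \matrix_(i, j) (M i j *: T).

(* [LCconn K a 0 b] is the component function A_a^b. *)
Definition Dirac (K : numFieldType) (mu : K) : 'End(spinor K) :=
  spinop (\sum_a tens (dop K (cl a)) (gam mu a)
    - \sum_a \sum_b tens (mulop (LCconn K a 0 b)) (gam mu b *m tau K a)).

Definition Dirac0_mx (K : numFieldType) : 'M['End(funA4 K)]_3 :=
  let Rt := Rop K t4 in let Rx := Rop K x4 in
  let Ry := Rop K y4 in let Rz := Rop K z4 in
  mx3 [:: [:: - Rt - Rx - Ry - Rz; 0; Rt - Rx - Ry + Rz];
          [:: Rt - Rx + Ry - Rz; - Rt - Rx - Ry - Rz; 0];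
          [:: 0; Rt + Rx - Ry - Rz; - Rt - Rx - Ry - Rz]].

Definition cexp (R : realType) (z : complex R) : complex R :=
  let: Complex a b := z in Complex (expR a * cos b) (expR a * sin b).

Definition qroot (R : realType) : complex R :=
  cexp (Complex 0 (2 * pi / 3)).

(* Main.v *)
(* Since rho_W(t) + rho_W(x) + rho_W(y) + rho_W(z) = 0, the Dirac operator for
   mu = 0 is A - B with A = sum_a R_a rho_W(a) and B = sum_a R_a. The class C
   is the coset of t modulo the Klein group, so B only sees a spinor through
   its sums over the three cosets; A is conjugate to B by psi(g) |->
   rho_W(g) psi(g), so D has rank at most 9 + 9. Conversely each character chi
   of A4 / {e, u, v, w} = Z/3 gives the eigenspaces {chi(g) w} and
   {chi(g) rho_W(g)^-1 w}, w in W, of eigenvalues -4 chi(t) and 4 chi(t). As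
   18 + 6 * 3 = 36, all these lower bounds on dimensions are equalities. *)
From HB Require Import structures.
Require Import Defs.
From mathcomp Require Import all_boot all_order all_algebra all_fingroup.
From mathcomp Require Import reals complex.
From mathcomp Require Import exp trigo ring lra.
Set Implicit Arguments.
Unset Strict Implicit.
Unset Printing Implicit Defensive.
Import Order.TTheory GRing.Theory Num.Theory.
Local Open Scope ring_scope.

(** * Eigenspaces of an endomorphism and their dimensions *)

Lemma leigenspaceP (F : fieldType) (vT : vectType F) (f : 'End(vT)) c v :
  reflect (f v = c *: v) (v \in passmx.leigenspace f c).
Proof.
rewrite memv_ker !lfunE /= opp_lfunE scale_lfunE id_lfunE subr_eq0.
exact: eqP.
Qed.

Lemma foldr_leigenspace (F : fieldType) (vT : vectType F) (f : 'End(vT))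
    (c : F) (v : vT) (s : seq F) :
  v \in passmx.leigenspace f c ->
  foldr (fun b h => (h \o (f - b *: \1))%VF) \1%VF s v
    = (\prod_(b <- s) (c - b)) *: v.
Proof.
move=> /leigenspaceP fv; elim: s => [|b s IHs] /=.
  by rewrite big_nil lfunE scale1r.
rewrite comp_lfunE !lfunE /= opp_lfunE scale_lfunE id_lfunE fv -scalerBl.
by rewrite linearZ /= IHs scalerA big_cons.
Qed.

(* The product of the [f - c j] over [j != i] kills every eigenspace but the
   i-th, on which it is a nonzero scalar. *)
Lemma directv_leigenspace (F : fieldType) (vT : vectType F) (I : finType)
    (f : 'End(vT)) (c : I -> F) :
  injective c -> directv (\sum_i passmx.leigenspace f (c i)).
Proof.
move=> c_inj; apply/directv_sum_independent => v fv v0 i _.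
have := congr1
  (foldr (fun b h => (h \o (f - b *: \1))%VF) \1%VF [seq c j | j in predC1 i]) v0.
rewrite linear0 linear_sum (bigD1 i) //= big1 => [|j ji].
  rewrite addr0 (foldr_leigenspace _ (fv i isT)) => /eqP; rewrite scaler_eq0.
  rewrite big_image prodf_seq_eq0 => /orP[/hasP[j _ /andP[ji]]|/eqP //].
  by rewrite subr_eq0 => /eqP /c_inj ij; rewrite !inE ij eqxx in ji.
rewrite (foldr_leigenspace _ (fv j isT)) big_image /=.
by rewrite (bigD1 j) //= subrr mul0r scale0r.
Qed.

(** Eigenspaces for distinct eigenvalues are independent, so their dimensions add up to at most that
    of the whole space; lower bounds that already fill it must all be sharp. *)
Lemma dim_leigenspace_eq (F : fieldType) (vT : vectType F) (I : finType)
    (f : 'End(vT)) (c : I -> F) (d : I -> nat) :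
  injective c -> (forall i, d i <= \dim (passmx.leigenspace f (c i)))%N ->
  (\dim {:vT} <= \sum_i d i)%N ->
  forall i, \dim (passmx.leigenspace f (c i)) = d i.
Proof.
move=> c_inj le_d le_sum i.
have le_dim : (\sum_i \dim (passmx.leigenspace f (c i)) <= \sum_i d i)%N.
  apply: leq_trans le_sum.
  have /directvP /= <- := directv_leigenspace f c_inj.
  exact/dimvS/subvf.
have := leqif_sum (fun i (_ : xpredT i) => leqif_eq (le_d i)) => /geq_leqif.
by rewrite le_dim => /esym/forall_inP/(_ i isT)/eqP ->.
Qed.

Lemma dim_limg_lker0 (F : fieldType) (aT rT : vectType F)
    (f : 'Hom(aT, rT)) (U : {vspace rT}) :
  lker f == 0%VS -> (forall v, f v \in U) -> (dim aT <= \dim U)%N.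
Proof.
move=> /eqP kf fU; rewrite -dimvf -(@limg_dim_eq _ _ _ f) ?kf ?capv0 //.
by apply/dimvS/subvP => _ /memv_imgP[v _ ->].
Qed.

(** * Cosets of the Klein group and sums over the class C *)

Lemma clE a : cl a = comp4 (tnth klein4 a) t4.
Proof.
by case: a => -[|[|[|[|]]]] ha //; rewrite /cl !(tnth_nth 1%g) //= /comp4 mulg1.
Qed.

(* The class of g in A4 / {e, u, v, w}, identified with Z/3 through t |-> 1. *)
Definition t_degree (g : A4) : 'I_3 :=
  if [pick p | g == elt4 p] is Some p then p.2 else 0.

Lemma t_degree_elt4 p : t_degree (elt4 p) = p.2.
Proof.
rewrite /t_degree; case: pickP => [p' /eqP /elt4_inj -> //|/(_ p)].
by rewrite eqxx.
Qed.

(* Each rho_W(g) is a monomial matrix supported on one cyclic diagonal, the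
   [t_degree g]-th; this makes [t_degree] multiplicative. *)
Definition shift_mx (K : numFieldType) (k : 'I_3) (M : 'M[K]_3) :=
  forall i j, i != j + k -> M i j = 0.

Lemma shift_mxM (K : numFieldType) k l (M N : 'M[K]_3) :
  shift_mx k M -> shift_mx l N -> shift_mx (k + l) (M *m N).
Proof.
move=> sM sN i j ij; rewrite mxE big1 // => m _.
have [ml|/sN ->] := eqVneq m (j + l); last by rewrite mulr0.
by rewrite sM ?mul0r // ml -addrA [l + k]addrC.
Qed.

Lemma shift_rho_t (K : numFieldType) : shift_mx 1 (rho_t K).
Proof.
by move=> [[|[|[|]]] hi] // [[|[|[|]]] hj] // ; rewrite -val_eqE mxE.
Qed.

Lemma shift_rho_klein (K : numFieldType) n : shift_mx 0 (tnth (rho_klein K) n).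
Proof.
move=> i j; rewrite addr0; case: n => -[|[|[|[|]]]] hn //; rewrite (tnth_nth 0) /=;
case: i => [[|[|[|]]] hi] //; case: j => [[|[|[|]]] hj] //;
by rewrite -val_eqE ?mxE.
Qed.

Lemma rhoW_elt4 (K : numFieldType) p :
  rhoW K (elt4 p) = tnth (rho_klein K) p.1 *m rho_t K ^+ p.2.
Proof.
rewrite /elt4 rhoWM rhoW_klein; congr (_ *m _).
elim: (nat_of_ord p.2) => [|k IHk]; first by rewrite expg0 rhoW1 expr0.
by rewrite expgSr exprS -mulmxE -IHk -rhoW_t -rhoWM.
Qed.

Lemma shift_rhoW (K : numFieldType) g : shift_mx (t_degree g) (rhoW K g).
Proof.
have [p ->] := elt4_surj g; rewrite t_degree_elt4 rhoW_elt4 -[X in shift_mx X]add0r.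
apply: shift_mxM; first exact: shift_rho_klein.
(* The exponent becomes a multiple of 1 in Z/3, so that each factor [rho_t] accounts for one
   shift. *)
rewrite -[X in shift_mx X]natr_Zp.
elim: (nat_of_ord p.2) => [|k IHk].
  by rewrite expr0 => i j; rewrite mulr0n addr0 mxE => /negPf ->.
by rewrite exprS -mulmxE mulrS; apply: shift_mxM IHk; apply: shift_rho_t.
Qed.

Lemma rhoW_mulVl (K : numFieldType) g : rhoW K g^-1%g *m rhoW K g = 1%:M.
Proof. by rewrite -rhoWM /comp4 mulgV rhoW1. Qed.

Lemma rhoW_mulVr (K : numFieldType) g : rhoW K g *m rhoW K g^-1%g = 1%:M.
Proof. by rewrite -rhoWM /comp4 mulVg rhoW1. Qed.

(** Supported on two distinct cyclic diagonals, [rhoW K g] would vanish, yet it is invertible. *)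
Lemma shift_rhoW_inj (K : numFieldType) g k :
  shift_mx k (rhoW K g) -> k = t_degree g.
Proof.
move=> sk; apply/eqP; apply: contraT => ne.
have g0 : rhoW K g = 0.
  apply/matrixP => i j; rewrite mxE.
  have [ik|/sk //] := eqVneq i (j + k).
  by rewrite shift_rhoW // ik (inj_eq (addrI _)).
have /matrixP/(_ 0 0) := rhoW_mulVl K g; rewrite g0 mulmx0 !mxE => /esym/eqP.
by rewrite oner_eq0.
Qed.

Lemma t_degreeM g h : t_degree (comp4 g h) = t_degree g + t_degree h.
Proof.
(* The statement mentions no field, so the representation is taken over [rat]. *)
apply/esym/(@shift_rhoW_inj rat); rewrite rhoWM.
by apply: shift_mxM; apply: shift_rhoW.
Qed.

Lemma clE_elt4 a : cl a = elt4 (a, 1).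
Proof. by rewrite clE /elt4 /= expg1. Qed.

Lemma t_degree_cl a : t_degree (cl a) = 1.
Proof. by rewrite clE_elt4 t_degree_elt4. Qed.

(** Left translation by g carries C, the elements of degree 1, bijectively onto the elements of
    degree [t_degree g + 1], so the sum depends only on the coset of g. *)
Lemma sum_class (V : nmodType) (F : A4 -> V) (g : A4) :
  \sum_a F (comp4 g (cl a)) = \sum_(h | t_degree h == t_degree g + 1) F h.
Proof.
rewrite (reindex (comp4 g)); last first.
  by exists (comp4 g^-1%g) => h _; rewrite /comp4 ?mulgK ?mulgKV.
rewrite (eq_bigl (fun h => t_degree h == 1)) => [|h]; last first.
  by rewrite t_degreeM (inj_eq (addrI _)).
rewrite (reindex (fun a => cl a)); last first.
  (* The inverse reads off the Klein component of h; by [elt4_surj] the default [(0, 0)] is never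
     reached. *)
  exists (fun h => (odflt (0, 0) [pick p | h == elt4 p]).1) => [a _|h].
    rewrite clE_elt4; case: pickP => [p /eqP /elt4_inj <- //|/(_ (a, 1))].
    by rewrite eqxx.
  have [[a k] ->] := elt4_surj h; rewrite inE t_degree_elt4 /= => /eqP ->.
  case: pickP => [p /eqP /elt4_inj <- /=|/(_ (a, 1))]; first by rewrite clE_elt4.
  by rewrite eqxx.
by apply: eq_bigl => a; rewrite t_degree_cl eqxx.
Qed.

(** The three diagonal entries are the nontrivial characters of the Klein group, each of which sums
    to zero. *)
Lemma sum_rho_klein (K : numFieldType) : \sum_n tnth (rho_klein K) n = 0.
Proof.
rewrite !big_ord_recl big_ord0 !(tnth_nth 0) /=.
apply/matrixP => -[[|[|[|]]] hi] // [[|[|[|]]] hj] //; rewrite !mxE /=; ring.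
Qed.

Lemma sum_rhoW_cl (K : numFieldType) : \sum_a rhoW K (cl a) = 0.
Proof.
under eq_bigr do rewrite clE rhoWM rhoW_klein.
by rewrite -mulmx_suml sum_rho_klein mul0mx.
Qed.

Lemma sum_rhoW_clV (K : numFieldType) : \sum_a rhoW K (cl a)^-1%g = 0.
Proof.
have kleinV n : rhoW K (tnth klein4 n)^-1%g = tnth (rho_klein K) n.
  (* Each rho_W(n) is an involution, so the inverse of n t is sent to rho_W(t)^-1 rho_W(n) and the
     Klein sum factors out on the right. *)
  have nn : tnth (rho_klein K) n *m tnth (rho_klein K) n = 1%:M.
    case: n => -[|[|[|[|]]]] hn //; rewrite (tnth_nth 0) /= ?mulmx1 //;
    apply/matrixP => -[[|[|[|]]] hi] // [[|[|[|]]] hj] //;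
    rewrite !mxE !big_ord_recl big_ord0 !mxE /=; ring.
  by rewrite -[LHS]mulmx1 -nn mulmxA -{1}rhoW_klein rhoW_mulVl mul1mx.
under eq_bigr => a _.
  rewrite clE /comp4 invMg -/(comp4 t4^-1%g (tnth klein4 a)^-1%g) rhoWM kleinV.
  over.
by rewrite -mulmx_sumr sum_rho_klein mulmx0.
Qed.

(** * Spinors as W-valued functions, and matrices of operators *)

Definition spval (K : numFieldType) (psi : spinor K) (g : A4) : 'cV[K]_3 :=
  \col_i psi i g.

Lemma spval_inj (K : numFieldType) (psi phi : spinor K) :
  spval psi =1 spval phi -> psi = phi.
Proof.
by move=> e; apply/ffunP => i; apply/ffunP => g; have /colP/(_ i) := e g; rewrite !mxE.
Qed.

Lemma spinopB (K : numFieldType) (M N : 'M['End(funA4 K)]_3) :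
  spinop (M - N) = spinop M - spinop N.
Proof.
apply/lfunP => psi; rewrite !lfunE /= opp_lfunE; apply/ffunP => i.
rewrite !ffunE !spinopE -sumrB; apply: eq_bigr => j _.
by rewrite !mxE !lfunE /= opp_lfunE.
Qed.

Lemma spval_spinop_tens (K : numFieldType) (I : finType)
    (T : I -> 'End(funA4 K)) (M : I -> 'M[K]_3) psi g :
  spval (spinop (\sum_a tens (T a) (M a)) psi) g =
  \sum_a M a *m \col_j T a (psi j) g.
Proof.
apply/colP => i; rewrite mxE spinopE summxE sum_ffunE.
under eq_bigr => j _.
  rewrite summxE sum_lfunE sum_ffunE; over.
rewrite exchange_big; apply: eq_bigr => a _; rewrite mxE.
by apply: eq_bigr => j _; rewrite !mxE scale_lfunE ffunE.
Qed.

Lemma spinop_tens1 (K : numFieldType) c :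
  spinop (tens \1%VF (c%:M : 'M[K]_3)) = c *: \1%VF.
Proof.
apply/lfunP => psi; rewrite scale_lfunE id_lfunE; apply/ffunP => i.
rewrite spinopE (bigD1 i) //= big1 => [|j ji].
  by rewrite addr0 !mxE eqxx mulr1n scale_lfunE id_lfunE ffunE.
by rewrite !mxE eq_sym (negPf ji) mulr0n scale0r lfunE.
Qed.

(** * The inverse metric, the gamma-matrices and their sums over C *)

Lemma rhoW_clE (K : numFieldType) a :
  rhoW K (cl a) = tnth (rho_klein K) a *m rho_t K.
Proof. by rewrite clE rhoWM rhoW_klein rhoW_t. Qed.

Lemma metric_denom_neq0 (K : numFieldType) (mu : K) :
  mu != - 4^-1 -> 1 + 4 * mu != 0.
Proof.
have n4 : (4 : K) != 0 by rewrite pnatr_eq0.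
apply: contraNneq => h; apply/eqP/(mulfI n4).
by rewrite mulrN divff //; apply/eqP; rewrite -addr_eq0 addrC h.
Qed.

(* [metric mu = 1 + mu J] with J the all-ones matrix and J^2 = 4 J, whence
   [1 - mu / (1 + 4 mu) J] as inverse. *)
Lemma invmx_metric (K : numFieldType) (mu : K) : mu != - 4^-1 ->
  invmx (metric mu) = \matrix_(a, b) ((a == b)%:R - mu / (1 + 4 * mu)).
Proof.
move=> mu4; have nz := metric_denom_neq0 mu4.
set N := (X in _ = X).
have MN : metric mu *m N = 1%:M.
  apply/matrixP => a b; rewrite !mxE.
  transitivity (\sum_c ((a == c)%:R * (c == b)%:R + (c == b)%:R * mu
     - (a == c)%:R * (mu / (1 + 4 * mu)) - mu * (mu / (1 + 4 * mu)))).
    by apply: eq_bigr => c _; rewrite !mxE; ring.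
  have pick1 (d : 'I_4) (F : 'I_4 -> K) : \sum_c (d == c)%:R * F c = F d.
    rewrite (bigD1 d) //= eqxx mul1r big1 ?addr0 // => c cd.
    by rewrite eq_sym (negPf cd) mul0r.
  rewrite !sumrB big_split /= !pick1 sumr_const card_ord.
  under [X in _ + X - _ - _]eq_bigr do rewrite eq_sym.
  by rewrite pick1; field.
have /mulmx1_unit[uM _] := MN.
by rewrite -[LHS]mulmx1 -MN mulmxA mulVmx // mul1mx.
Qed.

(** Since the sum of rho_W(b) - 1 over C is -4, the all-ones part of the inverse metric contributes
    4 mu / (1 + 4 mu), which added to -1 gives the scalar. *)
Lemma gamE (K : numFieldType) (mu : K) a : mu != - 4^-1 ->
  gam mu a = rhoW K (cl a) - (1 + 4 * mu)^-1%:M.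
Proof.
move=> mu4; have nz := metric_denom_neq0 mu4.
rewrite /gam invmx_metric // rhoW1.
under eq_bigr => b _.
  rewrite mxE scalerBl; over.
rewrite sumrB -scaler_sumr sumrB sum_rhoW_cl sumr_const card_ord sub0r.
rewrite (bigD1 a) //= eqxx scale1r big1 => [|b ba]; last first.
  by rewrite eq_sym (negPf ba) scale0r.
rewrite addr0 scalerN opprK -addrA; congr (_ + _).
apply/matrixP => i j; rewrite !(mxE, mulmxnE).
case: (i == j); rewrite ?mulr1n ?mulr0n; last by ring.
by field.
Qed.

Lemma sum_tau (K : numFieldType) : \sum_a tau K a = (- 4)%:M.
Proof.
rewrite /tau sumrB sum_rhoW_clV rhoW1 sumr_const card_ord sub0r raddfN.
by apply/matrixP => i j; rewrite !(mxE, mulmxnE) -mulrnA mulnC mulrnA.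
Qed.

Lemma sum_gam (K : numFieldType) (mu : K) : mu != - 4^-1 ->
  \sum_a gam mu a = (- (4 * (1 + 4 * mu)^-1))%:M.
Proof.
move=> mu4; under eq_bigr do rewrite gamE //.
rewrite sumrB sum_rhoW_cl sumr_const card_ord sub0r raddfN.
apply/matrixP => i j; rewrite !(mxE, mulmxnE); case: (i == j); ring.
Qed.

Lemma sum_gam_tau (K : numFieldType) (mu : K) : mu != - 4^-1 ->
  \sum_a gam mu a *m tau K a = (4 + 4 * (1 + 4 * mu)^-1)%:M.
Proof.
move=> mu4; set s := (1 + 4 * mu)^-1.
(* In the expansion of (rho_W(a) - s)(rho_W(a)^-1 - 1) only the constant 1 + s survives summation
   over C. *)
transitivity (\sum_a ((1%:M + s%:M) - rhoW K (cl a) - s *: rhoW K (cl a)^-1%g)).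
  apply: eq_bigr => a _; rewrite gamE // /tau rhoW1 mulmxBl !mulmxBr.
  rewrite rhoW_mulVr !mulmx1 mul_scalar_mx -/s.
  by apply/matrixP => i j; rewrite !mxE; ring.
rewrite !sumrB -scaler_sumr sum_rhoW_clV sum_rhoW_cl scaler0 !subr0.
rewrite sumr_const card_ord.
apply/matrixP => i j; rewrite !(mxE, mulmxnE); case: (i == j); ring.
Qed.

(** * The connection term of the Dirac operator *)

Lemma mulop_cstf (K : numFieldType) (c : K) : mulop (cstf c) = c *: \1%VF.
Proof.
apply/lfunP => f; rewrite mulopE scale_lfunE id_lfunE.
by apply/ffunP => g; rewrite !ffunE.
Qed.

Lemma LCconnE (K : numFieldType) a b :
  LCconn K a 0 b = cstf ((a == b)%:R - 4^-1).
Proof.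
rewrite !mxE eqxx /= summxE (bigD1 b) //= big1 => [|d db]; last first.
  by rewrite mxE eq_sym (negPf db).
rewrite mxE !eqxx addr0 mulr1 eq_sym; apply/ffunP => g; rewrite !ffunE.
by case: (a == b); rewrite ffunE.
Qed.

Lemma tensZl (K : numFieldType) c T (M : 'M[K]_3) :
  tens (c *: T) M = tens T (c *: M).
Proof. by apply/matrixP => i j; rewrite !mxE scalerA mulrC. Qed.

Lemma tens_sumr (K : numFieldType) (I : finType) T (M : I -> 'M[K]_3) :
  \sum_a tens T (M a) = tens T (\sum_a M a).
Proof.
apply/matrixP => i j; rewrite summxE mxE summxE scaler_suml.
by apply: eq_bigr => a _; rewrite mxE.
Qed.

(** The components A_a^b are the constants delta_ab - 1/4. With s = (1 + 4 mu)^-1 the connection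
    term is therefore sum_a gamma_a tau^a - 1/4 (sum_b gamma_b)(sum_a tau^a) = (4 + 4 s) - 4 s =
    4. *)
Lemma DiracE (K : numFieldType) (mu : K) : mu != - 4^-1 ->
  Dirac mu = spinop (\sum_(a < 4) tens (dop K (cl a)) (gam mu a)) - 4 *: \1%VF.
Proof.
move=> mu4; rewrite /Dirac spinopB -spinop_tens1; congr (_ - spinop _).
transitivity (tens \1%VF (\sum_a \sum_b
    ((a == b)%:R - 4^-1) *: (gam mu b *m tau K a))).
  rewrite -tens_sumr; apply: eq_bigr => a _; rewrite -tens_sumr.
  by apply: eq_bigr => b _; rewrite LCconnE mulop_cstf tensZl.
congr (tens _ _).
transitivity (\sum_a (gam mu a *m tau K a
    - 4^-1 *: ((\sum_b gam mu b) *m tau K a))).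
  apply: eq_bigr => a _; rewrite [X in _ - _ *: X]mulmx_suml scaler_sumr.
  under eq_bigr do rewrite scalerBl.
  rewrite sumrB; congr (_ - _).
  rewrite (bigD1 a) //= eqxx scale1r big1 ?addr0 // => b ba.
  by rewrite eq_sym (negPf ba) scale0r.
rewrite sumrB -scaler_sumr -mulmx_sumr sum_gam_tau // sum_gam // sum_tau.
rewrite -scalar_mxM scale_scalar_mx -raddfB; congr _%:M.
have nz := metric_denom_neq0 mu4; by field.
Qed.

(** * The Dirac operator at mu = 0 *)

Lemma mu0_neq (K : numFieldType) : (0 : K) != - 4^-1.
Proof. by rewrite eq_sym oppr_eq0 invr_eq0 pnatr_eq0. Qed.

Lemma gam0E (K : numFieldType) a : gam 0 a = rhoW K (cl a) - 1%:M.
Proof. by rewrite gamE ?mu0_neq // mulr0 addr0 invr1. Qed.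

Lemma Dirac0E (K : numFieldType) :
  Dirac (0 : K) = spinop (\sum_a tens (Rop K (cl a)) (gam 0 a)).
Proof.
rewrite DiracE ?mu0_neq // -spinop_tens1 -spinopB; congr spinop.
(* The gamma-matrices now sum to -4, so the identity parts of the R_a - id contribute 4 and cancel
   the constant term. *)
have -> : 4%:M = - \sum_a gam (0 : K) a.
  by rewrite sum_gam ?mu0_neq // mulr0 addr0 invr1 mulr1 raddfN opprK.
apply/matrixP => i j; rewrite !(mxE, summxE) -sumrN scaler_suml -sumrB.
by apply: eq_bigr => a _; rewrite !mxE /dop scalerBr scaleNr opprK subrK.
Qed.

Lemma Dirac0_mxE (K : numFieldType) : Dirac (0 : K) = spinop (Dirac0_mx K).
Proof.
rewrite Dirac0E; congr spinop; rewrite !big_ord_recl big_ord0 addr0.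
rewrite !gam0E !rhoW_clE !(tnth_nth 0) /cl !(tnth_nth 1%g) /=.
apply/matrixP => i j; rewrite [RHS]mxE.
case: i => [[|[|[|]]] hi] //; case: j => [[|[|[|]]] hj] //=.
all: rewrite !mxE !big_ord_recl !big_ord0 !mxE /=.
all: by rewrite !(mulr0, mul0r, mulr1, addr0, add0r, sub0r, subr0, scale0r,
  scaleN1r, scale1r, addrA).
Qed.

Lemma spval_Dirac0 (K : numFieldType) (psi : spinor K) g :
  spval (Dirac 0 psi) g =
  \sum_a (rhoW K (cl a) - 1%:M) *m spval psi (comp4 g (cl a)).
Proof.
rewrite Dirac0E spval_spinop_tens; apply: eq_bigr => a _; rewrite gam0E.
by congr (_ *m _); apply/colP => i; rewrite !mxE RopE.
Qed.

Lemma spvalZ (K : numFieldType) c (psi : spinor K) g :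
  spval (c *: psi) g = c *: spval psi g.
Proof. by apply/colP => i; rewrite !mxE !ffunE. Qed.

(** * Lower bounds on the dimensions of the eigenspaces *)

Definition spinor_of (K : numFieldType) (F : A4 -> 'cV[K]_3) : spinor K :=
  [ffun i => [ffun g => F g i 0]].

Lemma spinor_ofK (K : numFieldType) F : spval (@spinor_of K F) =1 F.
Proof. by move=> g; apply/colP => i; rewrite mxE !ffunE. Qed.

Lemma linear_spinor_of (K : numFieldType) (V : lmodType K) (F : A4 -> V -> 'cV[K]_3) :
  (forall g, linear (F g)) -> linear (fun v => spinor_of (fun g => F g v)).
Proof.
move=> linF c v w; apply/ffunP => i; apply/ffunP => g.
by rewrite !ffunE linF !mxE.
Qed.

(** The second hypothesis is the eigenvalue equation for the spinors g |-> F(g) w; evaluation at the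
    identity, where F is invertible, recovers w, so these spinors form a 3-dimensional space. *)
Lemma dim_leigenspace_ge3 (K : numFieldType) (c : K) (F : A4 -> 'M[K]_3) :
  F 1%g \in unitmx ->
  (forall g, \sum_a (rhoW K (cl a) - 1%:M) *m F (comp4 g (cl a)) = c *: F g) ->
  (3 <= \dim (passmx.leigenspace (Dirac (0 : K)) c))%N.
Proof.
move=> F1 DF; pose f w := spinor_of (fun g => F g *m w).
have linf : linear f.
  apply: (@linear_spinor_of K 'cV[K]_3 (fun g w => F g *m w)) => g d v w.
  by rewrite mulmxDr scalemxAr.
pose fL := GRing.isLinear.Build _ _ _ _ _ linf.
pose fl : {linear 'cV[K]_3 -> spinor K} := HB.pack f fL.
apply: (@dim_limg_lker0 _ 'cV[K]_3 _ (linfun fl)).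
  apply/eqP/vspaceP => w; rewrite memv_ker memv0 lfunE /=.
  apply/eqP/eqP => [fw0|->]; last by rewrite [f 0](linear0 fl).
  rewrite -[w](mulKmx F1) -(spinor_ofK (fun g => F g *m w)) -/(f w) fw0.
  suff -> : spval (0 : spinor K) 1%g = 0 by rewrite mulmx0.
  by apply/colP => i; rewrite !mxE !ffunE.
move=> w; rewrite lfunE /=; apply/leigenspaceP/spval_inj => g.
rewrite spval_Dirac0 spvalZ spinor_ofK scalemxAl -DF mulmx_suml.
by apply: eq_bigr => a _; rewrite spinor_ofK mulmxA.
Qed.

Lemma t_degree1 : t_degree 1%g = 0.
Proof. by apply: (addrI (t_degree 1%g)); rewrite -t_degreeM /comp4 mulg1 addr0. Qed.

(** Addition in ['I_3] wraps around at k = 2, where [q ^+ 3 = 1] makes up for it. *)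
Lemma expr_addI3 (K : numFieldType) (q : K) (k : 'I_3) : q ^+ 3 = 1 ->
  q ^+ (k + 1)%R = q * q ^+ k.
Proof.
by move=> q3; rewrite -exprS; case: k => -[|[|[|]]] hk //=; rewrite q3.
Qed.

Lemma dim_spinor (K : numFieldType) : \dim {: spinor K} = 36%N.
Proof.
by rewrite dimvf -[dim _]/(#|'I_3| * (#|A4| * 1))%N card_ord card_A4.
Qed.

(** The image of D lies in that of a map from pairs of 3 by 3 matrices, a space of dimension 9 + 9,
    and rank-nullity in dimension 36 bounds the kernel. *)
Lemma dim_leigenspace_ge18 (K : numFieldType) :
  (18 <= \dim (passmx.leigenspace (Dirac (0 : K)) 0))%N.
Proof.
pose G (MN : 'M[K]_3 * 'M[K]_3) := spinor_of (fun g =>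
  rhoW K g^-1%g *m col (t_degree g) MN.1 - col (t_degree g) MN.2).
have linG : linear G.
  apply: (@linear_spinor_of K ('M[K]_3 * 'M[K]_3)%type (fun g MN =>
    rhoW K g^-1%g *m col (t_degree g) MN.1 - col (t_degree g) MN.2)).
  move=> g c [M N] [M' N']; rewrite /= !linearD !linearZ /=.
  by rewrite addrACA.
pose GL := GRing.isLinear.Build _ _ _ _ _ linG.
pose Gl : {linear ('M[K]_3 * 'M[K]_3)%type -> spinor K} := HB.pack G GL.
have le_img : (limg (Dirac (0 : K)) <= limg (linfun Gl))%VS.
  apply/subvP => _ /memv_imgP[psi _ ->].
  (* Column k holds the sum over the coset of degree k + 1, because D at g evaluates the spinor at
     the points g a, one degree higher. *)
  pose M (f : A4 -> 'cV[K]_3) : 'M[K]_3 :=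
    \matrix_(i, k) (\sum_(h | t_degree h == k + 1) f h) i 0.
  apply/memv_imgP; exists (M (fun h => rhoW K h *m spval psi h), M (spval psi)).
    exact: memvf.
  rewrite lfunE /=; apply: spval_inj => g; rewrite spval_Dirac0 spinor_ofK /=.
  have colM f : col (t_degree g) (M f) = \sum_a f (comp4 g (cl a)).
    by rewrite sum_class; apply/colP => i; rewrite !mxE.
  rewrite !colM mulmx_sumr -sumrB; apply: eq_bigr => a _.
  by rewrite mulmxBl mul1mx rhoWM !mulmxA rhoW_mulVl mul1mx.
have le18 : (\dim (limg (Dirac (0 : K))) <= 18)%N.
  apply: leq_trans (dimvS le_img) _.
  rewrite -[18%N]/(dim ('M[K]_3 * 'M[K]_3)%type) -dimvf.
  by rewrite -(limg_ker_dim (linfun Gl) fullv) leq_addl.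
have := limg_ker_dim (Dirac (0 : K)) fullv.
rewrite capfv /passmx.leigenspace scale0r subr0 dim_spinor => e.
rewrite -(leq_add2r (\dim (limg (Dirac (0 : K))))) e.
by rewrite -[36%N]/(18 + 18)%N leq_add2l.
Qed.

(** * The seven eigenvalues and their multiplicities *)

Section CubeRoot.

Variables (K : numFieldType) (q : K).
Hypotheses (q3 : q ^+ 3 = 1) (q1 : q != 1).

(** A single finite index type for all eigenvalues, in the form that [dim_leigenspace_eq] takes. *)
Definition dirac_ev (i : option (bool * 'I_3)) : K :=
  if i is Some (b, k) then (-1) ^+ b * (4 * q ^+ k) else 0.

Lemma prim3_root : 3.-primitive_root q.
Proof.
have [m prim_m m3] := prim_order_exists (isT : 0 < 3)%N q3.
have : m \in divisors 3 by rewrite -dvdn_divisors.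
rewrite !inE => /orP[|] /eqP m_eq; rewrite m_eq in prim_m => //.
by have := prim_expr_order prim_m; rewrite expr1 => /eqP; rewrite (negPf q1).
Qed.

(** Cubing a nonzero eigenvalue leaves 64 times its sign, which determines b; then k is determined
    because q is a primitive cube root of unity. *)
Lemma dirac_ev_inj : injective dirac_ev.
Proof.
have n4 : (4 : K) != 0 by rewrite pnatr_eq0.
have q0 : q != 0 by apply/eqP => q_0; move/eqP: q3; rewrite q_0 expr0n eq_sym oner_eq0.
have ev_neq0 (b : bool) (k : nat) : (-1) ^+ b * (4 * q ^+ k) != 0 :> K.
  by rewrite !mulf_neq0 ?signr_eq0 ?expf_neq0.
have cubeE (b : bool) (k : nat) : ((-1) ^+ b * (4 * q ^+ k)) ^+ 3 = 64 * (-1) ^+ b.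
  rewrite !exprMn -[(q ^+ k) ^+ 3]exprM mulnC exprM q3 expr1n.
  by case: b; rewrite ?expr0 ?expr1; ring.
move=> [[b k]|] [[b' k']|] //= e; first last.
- by have := ev_neq0 b' k'; rewrite -e eqxx.
- by have := ev_neq0 b k; rewrite e eqxx.
have := congr1 (fun x => x ^+ 3) e; rewrite !cubeE => /(mulfI _) eb.
have {}eb : b = b'.
  have n64 : (64 : K) != 0 by rewrite pnatr_eq0.
  have /eqP := eb n64; case: b b' {e eb} => [] [] //=.
    by rewrite expr0 expr1 eqNr oner_eq0.
  by rewrite expr0 expr1 eq_sym eqNr oner_eq0.
move: e; rewrite -eb => /(mulfI (negbT (signr_eq0 K b)))/(mulfI n4)/eqP.
rewrite (eq_prim_root_expr prim3_root) !modn_small // => /eqP kk.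
by congr (Some (_, _)); apply: val_inj.
Qed.

Lemma dim_leigenspace_dirac_ev i :
  \dim (passmx.leigenspace (Dirac 0) (dirac_ev i)) = (if i then 3 else 18)%N.
Proof.
pose d (i : option (bool * 'I_3)) := (if i then 3 else 18)%N.
apply: (@dim_leigenspace_eq _ _ _ _ _ d dirac_ev_inj) i => [[[b k]|]|]; first last.
- rewrite dim_spinor (bigD1 None) //= (eq_bigr (fun=> 3%N)) => [|[]] //.
  by rewrite sum_nat_const cardC1 card_option card_prod card_bool card_ord.
- exact: dim_leigenspace_ge18.
have qk3 : (q ^+ k) ^+ 3 = 1 by rewrite -exprM mulnC exprM q3 expr1n.
(* The character of A4 that factors through Z/3 and sends t to [q ^+ k]. *)
pose chi g := (q ^+ k) ^+ t_degree g.
have chi1 : chi 1%g = 1 by rewrite /chi t_degree1.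
have chiM g a : chi (comp4 g (cl a)) = q ^+ k * chi g.
  by rewrite /chi t_degreeM t_degree_cl expr_addI3.
case: b => /=.
  (* Translation by C multiplies chi by [q ^+ k], and the rho_W(a) - 1 sum to -4. *)
  apply: (@dim_leigenspace_ge3 _ _ (fun g => (chi g)%:M)) => [|g].
    by rewrite chi1 unitmx1.
  under eq_bigr do rewrite chiM.
  rewrite -mulmx_suml sumrB sum_rhoW_cl sumr_const card_ord sub0r.
  apply/matrixP => i j; rewrite mul_mx_scalar !(mxE, mulmxnE); ring.
(* Here (rho_W(a) - 1) rho_W(ga)^-1 = (1 - rho_W(a)^-1) rho_W(g)^-1, which sums to 4 rho_W(g)^-1
   over C. *)
apply: (@dim_leigenspace_ge3 _ _ (fun g => chi g *: rhoW K g^-1%g)) => [|g].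
  by rewrite chi1 scale1r invg1 rhoW1 unitmx1.
transitivity (\sum_a (q ^+ k * chi g) *:
    (rhoW K g^-1%g - rhoW K (cl a)^-1%g *m rhoW K g^-1%g)).
  apply: eq_bigr => a _; rewrite chiM -scalemxAr mulmxBl mul1mx; congr (_ *: (_ - _)).
    by rewrite {1}/comp4 invMg -/(comp4 (cl a)^-1%g g^-1%g) rhoWM mulmxA rhoW_mulVr mul1mx.
  by rewrite {1}/comp4 invMg -/(comp4 (cl a)^-1%g g^-1%g) rhoWM.
rewrite -scaler_sumr sumrB -mulmx_suml sum_rhoW_clV mul0mx subr0 sumr_const card_ord.
by apply/matrixP => i j; rewrite !(mxE, mulmxnE); ring.
Qed.

End CubeRoot.

(** * The root of unity q = exp(2 pi i / 3) *)

Section Qroot.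

Variable R : realType.

Let c : R := cos (2 * pi / 3).
Let s : R := sin (2 * pi / 3).

Lemma qrootE : qroot R = Complex c s.
Proof. by rewrite /qroot /= expR0 !mul1r. Qed.

Lemma cos_sin_2pi3 : [/\ c = - (1 / 2), s ^+ 2 = 3 / 4 & 0 < s].
Proof.
have pi0 := pi_gt0 R.
have s0 : 0 < s by apply: sin_gt0_pi; lra.
have cs : c ^+ 2 + s ^+ 2 = 1 by apply: cos2Dsin2.
(* cos (2 x) = cos (2 pi - x) = cos x at x = 2 pi / 3 *)
have c2 : c ^+ 2 *+ 2 - 1 = c.
  rewrite /c -cos_mulr2n -[in RHS]cosN -[in RHS]cosD2pi; congr cos.
  by field.
have cE : c = - (1 / 2).
  (* The relation [c2] factors as (c - 1)(2 c + 1) = 0, and c = 1 would force s = 0. *)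
  have c1 : c - 1 != 0 by apply/eqP => c1; nra.
  by apply: (mulfI c1); nra.
by split=> //; move: cs; rewrite cE; lra.
Qed.

(** The real part is c^2 - s^2 = -1/2 = c and the imaginary part 2 c s = -s. This places the
    conjugate of q among the powers of q that index the eigenvalues. *)
Lemma qroot_expr2 : qroot R ^+ 2 = (qroot R)^*.
Proof.
have [cE s2 _] := cos_sin_2pi3.
rewrite qrootE; apply/eqP; rewrite eq_complex /= -!expr2 s2 cE.
by apply/andP; split; apply/eqP; field.
Qed.

Lemma qroot_expr3 : qroot R ^+ 3 = 1.
Proof.
have [cE s2 _] := cos_sin_2pi3.
rewrite exprS qroot_expr2 qrootE; apply/eqP; rewrite eq_complex /=.
by rewrite mulrN opprK -!expr2 s2 cE; apply/andP; split; apply/eqP; field.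
Qed.

Lemma qroot_neq1 : qroot R != 1.
Proof.
have [_ _ s0] := cos_sin_2pi3.
by rewrite qrootE eq_complex /= negb_and (gt_eqF s0) orbT.
Qed.

End Qroot.

Theorem proposition5p1 (R : realType) :
  [/\ forall mu : complex R, mu != - 4^-1 ->
        Dirac mu = spinop (\sum_(a < 4) tens (dop _ (cl a)) (gam mu a))
                   - 4 *: \1%VF,
      Dirac (0 : complex R) = spinop (Dirac0_mx (complex R)),
      \dim {: spinor (complex R)} = 36%N,
      \dim (passmx.leigenspace (Dirac (0 : complex R)) 0) = 18%N
    & [/\ \dim (passmx.leigenspace (Dirac (0 : complex R)) 4) = 3%N,
          \dim (passmx.leigenspace (Dirac (0 : complex R)) (- 4)) = 3%N,
          \dim (passmx.leigenspace (Dirac (0 : complex R)) (4 * qroot R)) = 3%N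
        & [/\ \dim (passmx.leigenspace (Dirac (0 : complex R)) (- (4 * qroot R)))
                = 3%N,
              \dim (passmx.leigenspace (Dirac (0 : complex R)) (4 * (qroot R)^*))
                = 3%N
            & \dim (passmx.leigenspace (Dirac (0 : complex R)) (- (4 * (qroot R)^*)))
                = 3%N]]].
Proof.
have dimE := dim_leigenspace_dirac_ev (qroot_expr3 R) (qroot_neq1 R).
have dim3 (b : bool) (k : 'I_3) e : e = (-1) ^+ b * (4 * qroot R ^+ k) ->
    \dim (passmx.leigenspace (Dirac (0 : complex R)) e) = 3%N.
  by move=> ->; apply: (dimE (Some (b, k))).
split; last split; last split.
- exact: DiracE.
- exact: Dirac0_mxE.
- exact: dim_spinor.
- exact: (dimE None).
- by apply: (dim3 false 0); rewrite expr0 mul1r mulr1.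
- by apply: (dim3 true 0); rewrite expr1 mulN1r mulr1.
- by apply: (dim3 false 1); rewrite expr0 mul1r expr1.
- by apply: (dim3 true 1); rewrite expr1 mulN1r expr1.
(* In ['I_3] the index -1 is 2, so the power is q^2, the conjugate of q. *)
- by apply: (dim3 false (-1)); rewrite expr0 mul1r -qroot_expr2.
- by apply: (dim3 true (-1)); rewrite expr1 mulN1r -qroot_expr2.
Qed.
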